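(* Let $c=1/2-\sqrt{2}/4$. Suppose $k=k(n)\in\mathbb{N}$ and $d=d(n)$ is a nonnegative integer with $d\le cn-2$ such that $$k\ge 36\cdot 2^n\,\frac{(2d+1)_{d+1}}{(n-d)_{d+1}}.$$ Then, for $n$ large enough, $\mathrm{capt}_k(Q_n)\le 2d+1$. In particular, the same upper bound holds provided that $k\ge 36\cdot 2^n n\left(\frac{3d}{n(1-c)}\right)^{d+1}$ (with $d\le cn-2$).
   Context: $(x)_m=x(x-1)\cdots(x-m+1)$ denotes the falling factorial. $Q_n$ is the $n$-dimensional hypercube on $2^n$ vertices, viewed as a reflexive graph. The game of Cops and Robbers: cops choose starting vertices (round 0), then the robber; players alternate, cops (any subset) moving to adjacent vertices or staying put, then the robber moving or staying; cops win by occupying the robber's vertex. For $k$ at least the cop number, $\mathrm{capt}_k(G)$ is the minimum over $k$-cop strategies of the number of rounds (excluding round 0) until capture against an optimally evading robber.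
   Formalization: The ''in particular'' clause is stated only for d ≥ 1: for d = 0 its bound on k reads k ≥ 0, and capt_k(Q_n) ≤ 1 then fails, e.g. for k = n with n large, since n vertices dominate at most n(n+1) < 2^n vertices. *)

(* Defs.v *)
From HB Require Import structures.
From mathcomp Require Import all_boot all_order all_algebra.
From mathcomp Require Import all_classical all_reals all_analysis.

Set Implicit Arguments.
Unset Strict Implicit.
Unset Printing Implicit Defensive.

Import Order.TTheory GRing.Theory Num.Theory.
Import numFieldNormedType.Exports.

Local Open Scope classical_set_scope.
Local Open Scope ring_scope.

Definition hypercube (n : nat) : rel {ffun 'I_n -> bool} :=
  fun u v => #|[set i | u i != v i]%SET| == 1%N.

Section CopsAndRobbers.
Variables (R : realType) (V : finType) (e : rel V) (k : nat).

(* Adding the loops turns [e] into a reflexive graph: a player may stay put. *)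
Definition move (u v : V) : bool := (u == v) || e u v.

(* Given the positions [:: r_0; ...; r_(t-1)] of the robber so far, [s] returns
   the positions of the [k] cops in round [t]; [s [::]] is their initial
   placement. Several cops may share a vertex. The cops' own past positions are
   determined by [s], so this is a strategy depending on the whole history. *)
Definition cop_strategy := seq V -> 'I_k -> V.

Definition legal_strategy (s : cop_strategy) : Prop :=
  forall (h : seq V) (v : V) (i : 'I_k), move (s h i) (s (rcons h v) i).

(* [r t] is the robber's position at the end of round [t]. Since the cops'
   strategies are deterministic, a robber optimal against a given strategy is
   one following an optimal walk. *)
Definition robber_walk (r : nat -> V) : Prop :=
  forall t, move (r t) (r t.+1).

(* In round [t > 0] the cops first move, with the robber at [r t.-1], and then
   the robber moves to [r t]; capture may occur after either move. For [t = 0],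
   both alternatives say that the robber starts on a cop's vertex. *)
Definition captured_in (s : cop_strategy) (r : nat -> V) (t : nat) : Prop :=
  exists i : 'I_k, s (mkseq r t) i = r t.-1 \/ s (mkseq r t) i = r t.

(* [+oo] if the robber is never captured. *)
Definition capture_round (s : cop_strategy) (r : nat -> V) : \bar R :=
  ereal_inf [set (t%:R)%:E | t in captured_in s r].

(* Both infima are taken over sets of extended natural numbers, so they are
   minima; the value is [+oo] exactly when [k] is below the cop number. *)
Definition capt : \bar R :=
  ereal_inf [set ereal_sup [set capture_round s r | r in robber_walk]
            | s in legal_strategy].

End CopsAndRobbers.

Arguments capt R {V} e k.

(* Main.v *)
From mathcomp Require Import all_boot.
From mathcomp Require Import zify.

(** Put D = d + 1 and X = C(2d+1, d). Call a placement of cops spread if for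
    every vertex u and every d-set U of coordinates at least X cops differ from
    u in exactly D coordinates, all outside U.

    A spread placement wins in 2d+1 rounds. If the robber starts at v, each u
    with dist(u, v) = d sees at least X cops at distance D on the sphere of
    radius 2d+1 around v, while each of these cops sees X vertices u. By Hall's
    theorem the sphere of radius d is completely occupied after d+1 moves, with
    the robber still in the ball it bounds; the occupied sphere then shrinks by
    one in each of the d remaining rounds, again by a Hall matching.

    Spread placements exist. When 2^d >= n, choose the cops one by one,
    minimising the potential sum_{(u, U)} 8^(- number of good cops): it decays by
    the right factor and ends below 8^(-X). For smaller d the 2^n C(n, d) events
    are too many. Cut then m 2^a 2^r coordinates, with m about d^2, into m
    blocks whose coordinates are labelled by pairs (s, f) in GF(2^a) x GF(2^r).
    Adding up labels maps a vertex to a word in GF(2^a)^m and to a Reed-Solomon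
    syndrome in GF(2^r)^D. Flipping one coordinate in each of D blocks can
    produce any prescribed change of the word on these blocks together with any
    prescribed syndrome, because Vandermonde matrices are invertible. So it
    suffices to choose, by the same potential argument, a good multiset of words
    in GF(2^a)^m, where the number of events depends on d only, and to put cops
    on all vertices whose word is in the multiset and whose syndrome is a fixed
    one. *)

Set Implicit Arguments.
Unset Strict Implicit.
Unset Printing Implicit Defensive.

(** * Hall's theorem *)

Section Hall.
Variables (A B : finType).
Implicit Types (E : A -> B -> bool) (S L : {set A}).

Definition nbhd E S : {set B} := [set b | [exists a in S, E a b]].

Lemma nbhdU E S T : nbhd E (S :|: T) = nbhd E S :|: nbhd E T.
Proof.
apply/setP=> b; rewrite !inE; apply/existsP/orP => [[a] |].
  rewrite inE => /andP[/orP[aS|aT] Eab]; [left|right]; apply/existsP; exists a.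
    by rewrite aS.
  by rewrite aT.
by case=> /existsP[a /andP[aS Eab]]; exists a; rewrite inE aS ?orbT.
Qed.

(** Induction on [#|L|]. A tight proper nonempty subset splits the problem in two; without one, any
    edge may be chosen first. The point [b0] provides values when [L] is empty. *)
Lemma hall E L (b0 : B) :
  (forall S, S \subset L -> #|S| <= #|nbhd E S|) ->
  exists f : A -> B, {in L, forall a, E a (f a)} /\ {in L &, injective f}.
Proof.
move: {2}#|L|.+1 (ltnSn #|L|) => n.
elim: n E L => // n IHn E L ltLn hallL.
have [->|/set0Pn[a aL]] := eqVneq L set0.
  by exists (fun=> b0); split => [a|a a']; rewrite inE.
have [/existsP[S /and3P[SL S0 tight]]|noS] := boolP
    [exists S : {set A}, [&& S \proper L, S != set0 & #|nbhd E S| <= #|S|]].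
  have sSL := proper_sub SL.
  have [f1 [Ef1 injf1]] : exists f : A -> B,
      {in S, forall a, E a (f a)} /\ {in S &, injective f}.
    apply: IHn => [|T TS]; first exact: leq_trans (proper_card SL) _.
    exact: hallL (subset_trans TS sSL).
  (* Off [S], neighbours of [S] are forbidden; tightness of [S] preserves Hall's condition for
     [L :\: S]. *)
  pose E' a b := E a b && (b \notin nbhd E S).
  have [f2 [Ef2 injf2]] : exists f : A -> B,
      {in L :\: S, forall a, E' a (f a)} /\ {in L :\: S &, injective f}.
    apply: IHn => [|T TLS].
      rewrite cardsD (setIidPr sSL) -ltnS; apply: leq_trans _ ltLn; rewrite ltnS.
      by rewrite ltn_subrL !card_gt0 S0; apply/set0Pn; exists a.
    have /hallL : T :|: S \subset L.
      by rewrite subUset sSL (subset_trans TLS) // subsetDl.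
    have dTS : T :&: S = set0.
      by apply/setP=> x; rewrite !inE; apply/negbTE/negP => /andP[/(subsetP TLS)];
         rewrite inE => /andP[/negP].
    rewrite cardsU dTS cards0 subn0 nbhdU => le1.
    have /subset_leq_card : nbhd E T :|: nbhd E S \subset nbhd E' T :|: nbhd E S.
      apply/subsetP => b; rewrite !in_setU.
      have [|bS] := boolP (b \in nbhd E S); rewrite ?orbT // !orbF !in_set.
      case/existsP=> a' /andP[a'T Ea'b].
      by apply/existsP; exists a'; rewrite a'T /E' Ea'b bS.
    move=> le2; have le3 := leq_trans le1 (leq_trans le2 (leq_card_setU _ _)).
    by rewrite -(leq_add2r #|S|); apply: leq_trans le3 _; rewrite leq_add2l.
  have f1N x : x \in S -> f1 x \in nbhd E S.
    by move=> xS; rewrite inE; apply/existsP; exists x; rewrite xS Ef1.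
  have f2N x : x \in L -> x \notin S -> f2 x \notin nbhd E S.
    by move=> xL xS; have /andP[] : E' x (f2 x) by apply: Ef2; rewrite inE xS.
  exists (fun x => if x \in S then f1 x else f2 x); split=> [x xL|x y xL yL].
    case: ifPn => xS; first exact: Ef1.
    by have /andP[] : E' x (f2 x) by apply: Ef2; rewrite inE xS.
  case: ifPn => xS; case: ifPn => yS.
  - exact: injf1.
  - by move=> eqf; have := f2N _ yL yS; rewrite -eqf f1N.
  - by move=> eqf; have := f2N _ xL xS; rewrite eqf f1N.
  - by apply: injf2; rewrite inE ?xS ?yS.
(* No proper nonempty subset is tight, so each still has enough neighbours once [b] is removed. *)
have [b Eab] : exists b, E a b.
  have := hallL [set a]; rewrite sub1set cards1 => /(_ aL).
  rewrite card_gt0 => /set0Pn[b]; rewrite inE => /existsP[a' /andP[]].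
  by rewrite inE => /eqP-> Eab; exists b.
pose E' a' b' := E a' b' && (b' != b).
have [f [Ef injf]] : exists f : A -> B,
    {in L :\ a, forall a, E' a (f a)} /\ {in L :\ a &, injective f}.
  apply: IHn => [|S SL]; first by have := ltLn; rewrite (cardsD1 a) aL.
  have [->|S0] := eqVneq S set0; first by rewrite cards0.
  have prS : S \proper L.
    by apply: sub_proper_trans SL _; rewrite properD1.
  have : #|S| < #|nbhd E S|.
    rewrite ltnNge; apply/negP => tight; case/negP: noS.
    by apply/existsP; exists S; rewrite prS S0.
  rewrite (cardsD1 b) => ltS.
  have : #|S| <= #|nbhd E S :\ b|.
    by move: ltS; case: (_ \in _) => // /ltnW.
  move=> /leq_trans; apply; apply: subset_leq_card; apply/subsetP => b'.
  rewrite 2!inE => /andP[b'b /[!inE]/existsP[a' /andP[a'S Ea'b']]].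
  by apply/existsP; exists a'; rewrite a'S /E' Ea'b'.
exists (fun x => if x == a then b else f x); split => [x xL|x y xL yL].
  case: eqP => [->//|/eqP xa]; have /andP[] // : E' x (f x).
  by apply: Ef; rewrite !inE xa.
have fb z : z \in L -> z != a -> f z != b.
  by move=> zL za; have /andP[] // : E' z (f z) by apply: Ef; rewrite !inE za.
case: eqP => [->|/eqP xa]; case: eqP => [->//|/eqP ya].
- by move=> eqb; have := fb y yL ya; rewrite -eqb eqxx.
- by move=> eqb; have := fb x xL xa; rewrite eqb eqxx.
- by apply: injf; rewrite !inE ?xa ?ya.
Qed.

(** Count the edges leaving [S] from both ends: at least [c * #|S|], at most [c * #|nbhd E S|]. *)
Lemma hall_degree E L (b0 : B) (c : nat) : 0 < c ->
  {in L, forall a, c <= #|[set b | E a b]|} ->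
  (forall b, #|[set a in L | E a b]| <= c) ->
  exists f : A -> B, {in L, forall a, E a (f a)} /\ {in L &, injective f}.
Proof.
move=> c0 degL degR; apply: (hall b0) => S SL.
rewrite -(leq_pmul2r c0).
have: #|S| * c <= \sum_(a in S) #|[set b | E a b]|.
  rewrite -sum_nat_const; apply: leq_sum => a aS; exact/degL/(subsetP SL).
move=> /leq_trans; apply.
under eq_bigr => a _ do rewrite -sum1_card.
rewrite (exchange_big_dep (fun b => b \in nbhd E S)) /=; last first.
  move=> a b aS Eab; rewrite inE; apply/existsP; exists a; rewrite aS /=.
  by move: Eab; rewrite inE.
rewrite -sum_nat_const; apply: leq_sum => b _.
apply: leq_trans (degR b); rewrite sum1_card.
apply: subset_leq_card; apply/subsetP => a; rewrite !inE => /andP[aS].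
by rewrite inE (subsetP SL) // => ->.
Qed.

End Hall.

(** * Walks of the cops from a spread placement *)

Section Cube.
Variables (I : finType) (T : eqType).
Implicit Types (u v x y : {ffun I -> T}).

Definition hdiff u v : {set I} := [set i | u i != v i].

Lemma hdiffC u v : hdiff u v = hdiff v u.
Proof. by apply/setP=> i; rewrite !inE eq_sym. Qed.

Lemma hdiff_eq0 u v : (hdiff u v == set0) = (u == v).
Proof.
apply/eqP/eqP => [/setP e|->]; last by apply/setP=> i; rewrite !inE eqxx.
by apply/ffunP=> i; have := e i; rewrite !inE => /negbFE/eqP.
Qed.

Lemma hdiff_triangle u v x : #|hdiff u x| <= #|hdiff u v| + #|hdiff v x|.
Proof.
apply: leq_trans (leq_card_setU _ _); apply/subset_leq_card/subsetP => i.
by rewrite !inE; case: (u i =P v i) => [->|].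
Qed.

End Cube.

Section Hypercube.
Variable n : nat.
Local Notation V := {ffun 'I_n -> bool}.
Implicit Types (u v x y : V) (W U : {set 'I_n}).

Definition hflip u W : V := [ffun i => u i (+) (i \in W)].

Lemma hdiff_hflip u W : hdiff u (hflip u W) = W.
Proof. by apply/setP=> i; rewrite !inE ffunE; case: (u i); case: (i \in W). Qed.

Lemma hflip_hdiff u v : hflip u (hdiff u v) = v.
Proof. by apply/ffunP=> i; rewrite ffunE !inE; case: (u i); case: (v i). Qed.

Lemma hdiff_inj v : injective (hdiff v).
Proof. exact: can_inj (hflip_hdiff v). Qed.

Lemma in_hdiffD u v x i : (i \in hdiff u x) = (i \in hdiff u v) (+) (i \in hdiff v x).
Proof. by rewrite !inE; case: (u i); case: (v i); case: (x i). Qed.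

Definition hnear u v := #|hdiff u v| <= 1.

(** The target comes first so that [approach y] can be iterated; at [y] it stands still. *)
Definition approach y x : V :=
  if [pick i in hdiff x y] is Some i then hflip x [set i] else x.

Lemma hnear_approach y x : hnear x (approach y x).
Proof.
rewrite /hnear /approach; case: pickP => [i _|_]; first by rewrite hdiff_hflip cards1.
by rewrite (eqP (_ : hdiff x x == set0)) ?cards0 // hdiff_eq0.
Qed.

Lemma card_hdiff_approach y x : #|hdiff (approach y x) y| = #|hdiff x y|.-1.
Proof.
rewrite /approach; case: pickP => [i ixy|/eq_card0->//].
rewrite (cardsD1 i (hdiff x y)) ixy; congr #|pred_of_set _|; apply/setP=> j.
rewrite in_setD1 !in_set ffunE in_set1.
move: ixy; rewrite inE; case: (j =P i) => [->|_] /=; last by rewrite addbF.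
by case: (x i); case: (y i).
Qed.

Lemma iter_approach y x t :
  #|hdiff (iter t (approach y) x) y| = #|hdiff x y| - t.
Proof.
elim: t => [|t IHt] /=; first by rewrite subn0.
by rewrite card_hdiff_approach IHt subnS.
Qed.

Lemma card_supersets1 W :
  n - #|W| <= #|[set U : {set 'I_n} | (W \subset U) && (#|U| == #|W|.+1)]|.
Proof.
have -> : n - #|W| = #|[set i |: W | i in ~: W]|.
  rewrite card_in_imset; first by have := cardsC W; rewrite card_ord; lia.
  move=> i j; rewrite !inE => iW jW /setP/(_ i).
  by rewrite !inE eqxx (negbTE iW) !orbF => /esym/eqP.
apply/subset_leq_card/subsetP => U /imsetP[i]; rewrite !inE => iW ->.
by rewrite subsetUr cardsU1 iW eqxx.
Qed.

Lemma card_subsets1 U :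
  #|[set W : {set 'I_n} | (W \subset U) && (#|U| == #|W|.+1)]| <= #|U|.
Proof.
apply: leq_trans (leq_imset_card (fun i => U :\ i) U).
apply/subset_leq_card/subsetP => W; rewrite inE => /andP[WU /eqP cU].
have : #|U :\: W| = 1 by rewrite cardsD (setIidPr WU) cU subSnn.
move/eqP/cards1P => [i UWi]; apply/imsetP; exists i.
  by have := set11 i; rewrite -UWi inE => /andP[].
by rewrite -UWi setDDr setDv set0U; apply/esym/setIidPr.
Qed.

(* A matching of each level below [d] into the next one lets a full sphere
   shrink to the next smaller full sphere in one move. *)
Lemma shrinking_map d v : 2 * d <= n -> exists f : V -> V,
  (forall x, hnear x (f x)) /\
  (forall u, #|hdiff v u| < d ->
     exists2 x, #|hdiff v x| = #|hdiff v u|.+1 & f x = u).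
Proof.
move=> dn; have [->|d0] := posnP d.
  exists id; split => // x; rewrite /hnear.
  by rewrite (eqP (_ : hdiff x x == set0)) ?cards0 // hdiff_eq0.
pose E W U := (W \subset U) && (#|U| == #|W|.+1).
have [h [Eh injh]] : exists h : {set 'I_n} -> {set 'I_n},
    {in [set W : {set 'I_n} | #|W| < d], forall W, E W (h W)} /\
    {in [set W : {set 'I_n} | #|W| < d] &, injective h}.
  (* As [2 * d <= n], a set [W] below level [d] has at least [d] successors; a set [U] of at most
     [d] elements has at most [d] predecessors, a larger one none. *)
  apply: (hall_degree set0 d0) => [W|U].
    rewrite inE => Wd; apply: leq_trans (card_supersets1 W).
    by rewrite leq_subRL ?(leq_trans (ltnW Wd)) //; lia.
  have [Ud|Ud] := leqP #|U| d.
    apply: leq_trans Ud; apply: leq_trans (card_subsets1 U).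
    by apply/subset_leq_card/subsetP => W; rewrite !inE => /andP[_].
  apply: leq_trans (leq0n _); rewrite leqn0 cards_eq0; apply/eqP/setP => W.
  by rewrite !inE /E; apply/negbTE/negP; lia.
pose f x : V := if [pick W : {set 'I_n} | (#|W| < d) && (h W == hdiff v x)] is Some W
  then hflip v W else x.
exists f; split => [x|u ud].
  rewrite /hnear /f; case: pickP => [W /andP[Wd /eqP hW]|_]; last first.
    by rewrite (eqP (_ : hdiff x x == set0)) ?cards0 // hdiff_eq0.
  have /andP[WU /eqP cU] : E W (h W) by apply: Eh; rewrite inE.
  have -> : hdiff x (hflip v W) = h W :\: W.
    apply/setP=> i; rewrite (in_hdiffD _ v) hdiff_hflip hdiffC -hW inE.
    by have := subsetP WU i; case: (i \in W); case: (i \in h W) => //= ->.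
  by rewrite cardsD (setIidPr WU) cU subSnn.
have /andP[WU /eqP cU] : E (hdiff v u) (h (hdiff v u)) by apply: Eh; rewrite inE.
exists (hflip v (h (hdiff v u))); rewrite ?hdiff_hflip // /f hdiff_hflip.
case: pickP => [W /andP[Wd /eqP hW]|/(_ (hdiff v u))]; last by rewrite ud eqxx.
by rewrite (injh _ _ _ _ hW) ?inE // hflip_hdiff.
Qed.

(** Cops are counted by index, since several may share a vertex. The threshold is the number of
    [d]-subsets of a set of size [2 * d + 1], the degree in Hall's condition. *)
Definition spread d (K : finType) (p : K -> V) :=
  forall u U, #|U| = d -> 'C(2 * d + 1, d) <=
    #|[set i | (#|hdiff u (p i)| == d.+1) && [disjoint hdiff u (p i) & U]]|.

(* The cops at distance [d] from a vertex [u] of the sphere, away from [v], lie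
   on the sphere of radius [2d+1] around [v]; such a cop sees [C(2d+1,d)]
   vertices of the sphere of radius [d], so that Hall's condition holds. *)
Lemma sphere_matching d (K : finType) (p : K -> V) v :
  2 * d <= n -> spread d p ->
  exists f : V -> K,
    {in [set u | #|hdiff v u| == d], forall u, #|hdiff (p (f u)) u| = d.+1} /\
    {in [set u | #|hdiff v u| == d] &, injective f}.
Proof.
move=> dn sp.
have X0 : 0 < 'C(2 * d + 1, d) by rewrite bin_gt0; lia.
have [U0 cU0] : exists U : {set 'I_n}, #|U| = d.
  have : 0 < #|[set U : {set 'I_n} | #|U| == d]|.
    by rewrite card_draws card_ord bin_gt0; lia.
  by case/card_gt0P=> U; rewrite inE => /eqP; exists U.
have [k0 _] : exists k : K, k \in K.
  have := leq_trans X0 (sp v U0 cU0).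
  by case/card_gt0P=> k _; exists k.
pose E u i := (#|hdiff u (p i)| == d.+1) && [disjoint hdiff u (p i) & hdiff v u].
have [f [Ef injf]] : exists f : V -> K,
    {in [set u | #|hdiff v u| == d], forall u, E u (f u)} /\
    {in [set u | #|hdiff v u| == d] &, injective f}.
  apply: (hall_degree k0 X0) => [u|i].
    by rewrite inE => /eqP ud; apply: sp.
  set L := [set u in _ | _].
  have LE u : u \in L -> [/\ #|hdiff v u| = d, hdiff v u \subset hdiff v (p i)
      & #|hdiff v (p i)| = 2 * d + 1].
    rewrite !inE => /andP[/eqP ud /andP[/eqP ui dis]].
    have -> : hdiff v (p i) = hdiff v u :|: hdiff u (p i).
      apply/setP=> j; rewrite (in_hdiffD _ u) in_setU.
      by move/pred0P: dis => /(_ j) /=; case: (j \in _); case: (j \in _).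
    split; rewrite ?subsetUl // cardsU setIC (disjoint_setI0 dis) cards0 ud ui; lia.
  have [->|/set0Pn[u0 /LE[_ _ cW]]] := eqVneq L set0; first by rewrite cards0.
  rewrite -(card_imset _ (@hdiff_inj v)) -cW -cards_draws.
  apply/subset_leq_card/subsetP => U /imsetP[u /LE[ud sub _] ->].
  by rewrite inE sub ud eqxx.
exists f; split => // u uL; have /andP[/eqP <- _] := Ef u uL.
by rewrite hdiffC.
Qed.

Lemma hnear_refl x : hnear x x.
Proof. by rewrite /hnear (eqP (_ : hdiff x x == set0)) ?cards0 // hdiff_eq0. Qed.

Lemma closing_walks d (K : finType) (p : K -> V) v :
  2 * d <= n -> spread d p ->
  exists w : K -> nat -> V,
  [/\ forall i, w i 0 = p i, forall i t, hnear (w i t) (w i t.+1)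
    & forall s u, #|hdiff v u| + s = d -> exists i, w i (d.+1 + s) = u].
Proof.
move=> dn sp; have [f [fd injf]] := sphere_matching v dn sp.
have [g [gn gs]] := shrinking_map v dn.
(* Since [f] is injective on the sphere, each cop has at most one target; a cop without target never
   moves. *)
pose tgt i := [pick u | (#|hdiff v u| == d) && (f u == i)].
pose w i t := if tgt i is Some u
  then iter (t - d.+1) g (iter (minn t d.+1) (approach u) (p i)) else p i.
exists w; split => [i|i t|].
- by rewrite /w; case: (tgt i).
- rewrite /w; case: (tgt i) => [u|]; last exact: hnear_refl.
  have [td|td] := ltnP t d.+1.
    have [-> -> ->] : [/\ t - d.+1 = 0, t.+1 - d.+1 = 0
      & minn t.+1 d.+1 = t.+1] by split; lia.
    exact: hnear_approach.
  have [-> ->] : t.+1 - d.+1 = (t - d.+1).+1 /\ minn t.+1 d.+1 = d.+1.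
    by split; lia.
  exact: gn.
move=> s u us.
(* The induction must keep [tgt i]: only a cop with a target follows [g] in the next move. *)
suff [i [_ ?]] : exists i, tgt i /\ w i (d.+1 + s) = u by exists i.
elim: s u us => [|s IHs] u ud.
  have uL : u \in [set u | #|hdiff v u| == d] by rewrite inE; lia.
  have tu : tgt (f u) = Some u.
    rewrite /tgt; case: pickP => [u'|/(_ u)]; last by rewrite !inE in uL *; rewrite uL eqxx.
    by case/andP=> u'd /eqP/injf <- //; rewrite inE.
  exists (f u); rewrite /w tu addn0 subnn minnn; split=> //.
  by apply/eqP; rewrite -hdiff_eq0 -cards_eq0 iter_approach fd ?subnn.
have [|x xd gx] := gs u; first by lia.
have [|i [ti wi]] := IHs x; first by lia.
exists i; split=> //; rewrite -gx -wi /w addnS; case: (tgt i) ti => // u' _ /=.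
have [-> -> ->] : [/\ (d.+1 + s).+1 - d.+1 = (d.+1 + s - d.+1).+1,
    minn (d.+1 + s) d.+1 = d.+1 & minn (d.+1 + s).+1 d.+1 = d.+1] by split; lia.
by [].
Qed.

End Hypercube.

(** * Counting *)

Lemma subset_extend (T : finType) (B : {set T}) d : #|B| <= d <= #|T| ->
  exists2 B' : {set T}, B \subset B' & #|B'| = d.
Proof.
case/andP=> Bd dT.
have : 0 < #|[set A : {set T} | A \subset ~: B & #|A| == d - #|B|]|.
  by rewrite cards_draws bin_gt0; have := cardsC B; lia.
case/card_gt0P=> A; rewrite inE subsetC => /andP[BA /eqP cA].
exists (B :|: A); first exact: subsetUl.
rewrite cardsU (_ : B :&: A = set0) ?cards0 ?cA; first lia.
by apply/eqP; rewrite setI_eq0 disjoints_subset.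
Qed.

Lemma leq_bin_exp2 m j : 'C(m, j) <= 2 ^ m.
Proof.
have := card_powerset [set: 'I_m]; rewrite cardsT card_ord => <-.
rewrite -[m in 'C(m, _)]card_ord -card_draws.
by apply/subset_leq_card/subsetP => A _; rewrite powersetE subsetT.
Qed.

Lemma leq_exp2_bin d : 2 ^ d <= 'C(2 * d + 1, d).
Proof.
elim: d => // d IHd.
have -> : 2 * d.+1 + 1 = (2 * d + 1).+2 by lia.
rewrite binS (binS _ d) expnS mul2n -addnn; apply: leq_add.
  exact: leq_trans IHd (leq_addl _ _).
exact: leq_trans IHd (leq_bin2l _ _).
Qed.

Lemma card_hdiff_eq (Sigma : finType) m (u : {ffun 'I_m -> Sigma}) (J : {set 'I_m}) :
  #|[set y | hdiff u y == J]| = #|Sigma|.-1 ^ #|J|.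
Proof.
pose F i : pred Sigma := [pred a | (u i != a) == (i \in J)].
have -> : #|[set y | hdiff u y == J]| = #|(family F : pred {ffun 'I_m -> Sigma})|.
  apply: eq_card => y; rewrite inE; apply/eqP/familyP => [eJ i|Fy].
    by change ((u i != y i) == (i \in J)); rewrite -eJ inE.
  by apply/setP=> i; have /eqP := Fy i; rewrite inE.
rewrite card_family foldrE big_image /= -prod_nat_const [RHS]big_mkcond /=.
apply: eq_bigr => i _; case: ifP => iJ.
  have -> : #|Sigma|.-1 = #|predC1 (u i)| by rewrite cardC1.
  by apply: eq_card => a; rewrite !inE /F iJ eqb_id eq_sym.
rewrite -[RHS](card1 (u i)); apply: eq_card => a.
by rewrite !inE /F iJ eqbF_neg negbK eq_sym.
Qed.

Lemma card_far_words (Sigma : finType) m d D (u : {ffun 'I_m -> Sigma}) (B : {set 'I_m}) :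
  #|B| = d ->
  #|[set y | (#|hdiff u y| == D) && [disjoint hdiff u y & B]]|
    = 'C(m - d, D) * #|Sigma|.-1 ^ D.
Proof.
move=> cB.
have -> : m - d = #|~: B| by have := cardsC B; rewrite card_ord cB; lia.
rewrite -cards_draws -sum1_card.
rewrite (partition_big (hdiff u) (mem [set J : {set 'I_m} | J \subset ~: B & #|J| == D])) /=.
  rewrite -sum_nat_const; apply: eq_bigr => J; rewrite inE => /andP[JB /eqP cJ].
  rewrite -[in RHS]cJ -(card_hdiff_eq u J) -sum1_card; apply: eq_bigl => y.
  rewrite !inE; have [->|_] := eqVneq (hdiff u y) J; rewrite ?andbF // cJ eqxx.
  by rewrite disjoints_subset JB.
by move=> y; rewrite !inE disjoints_subset andbC.
Qed.

(** * Bernoulli-type estimates and the numerical choice of parameters *)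

Lemma leq_mul_subD M s t : M * (M - (s + t)) <= (M - s) * (M - t).
Proof.
have [stM|stM] := leqP (s + t) M; last first.
  by rewrite (eqP (_ : M - (s + t) == 0)) ?muln0 // subn_eq0 ltnW.
have -> : M - s = M - (s + t) + t by lia.
have -> : M - t = M - (s + t) + s by lia.
move: (M - (s + t)) (subnK stM) => x <-; nia.
Qed.

Lemma bernoulli_exp x D : x ^ D * (x - D) <= x.-1 ^ D * x.
Proof.
elim: D => [|D IHD]; first by rewrite subn0.
have := leq_mul IHD (leqnn (x - 1)); have := leq_mul_subD x D 1.
rewrite !expnSr addn1 !subn1; nia.
Qed.

(** This is prod (1 - x_i) >= 1 - sum x_i with x_i = (e + i) / M for i < j, cleared of denominators;
    ['C(j, 2)] is the sum of these i. *)
Lemma bernoulli_ffact M e j :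
  M ^ j * (M - (j * e + 'C(j, 2))) <= (M - e) ^_ j * M.
Proof.
elim: j => [|j IHj]; first by rewrite subn0.
have := leq_mul IHj (leqnn (M - (e + j))).
have := leq_mul_subD M (j * e + 'C(j, 2)) (e + j).
have -> : j * e + 'C(j, 2) + (e + j) = j.+1 * e + 'C(j.+1, 2) by rewrite binS bin1; lia.
rewrite expnSr ffactnSr -subnDA => le1 le2.
apply: (@leq_trans (M ^ j * ((M - (j * e + 'C(j, 2))) * (M - (e + j))))).
  by rewrite -mulnA leq_mul2l le1 orbT.
by rewrite mulnA (leq_trans le2) // mulnAC.
Qed.

Lemma leq_bin_exp m d : 'C(m, d) <= m ^ d.
Proof.
apply: (@leq_trans (m ^_ d)); first by rewrite -bin_ffact leq_pmulr // fact_gt0.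
elim: d => // d IHd; rewrite ffactnSr expnSr; exact: leq_mul (leq_subr _ _).
Qed.

Lemma exp2_bracket c n : 0 < c <= n -> exists r, c * 2 ^ r <= n < 2 * (c * 2 ^ r).
Proof.
case/andP=> c0 cn.
have y0 : 0 < n %/ c by rewrite divn_gt0.
have /andP[le lt] := trunc_log_bounds (isT : 1 < 2) y0.
exists (trunc_log 2 (n %/ c)); apply/andP; split.
  by rewrite mulnC -leq_divRL.
by rewrite mulnCA -expnS mulnC -ltn_divLR.
Qed.

Lemma exp2_bracket_up c : 0 < c -> exists r, c <= 2 ^ r < 2 * c.
Proof.
move=> c0; have /andP[le lt] := trunc_log_bounds (isT : 1 < 2) c0.
have [eqc|neq] := eqVneq (2 ^ trunc_log 2 c) c.
  by exists (trunc_log 2 c); rewrite eqc leqnn; lia.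
exists (trunc_log 2 c).+1; rewrite (ltnW lt) expnS; lia.
Qed.

(** By Pascal's rule and symmetry the binomial at least triples at each step, while the cubic side
    grows more slowly. The bound fails at [d = 4], so that [sample_budget] treats small [d]
    apart. *)
Lemma cubic_lt_bin d : 5 <= d -> 2 * d.+1 ^ 3 + d.+1 ^ 2 <= 2 * 'C(2 * d + 1, d).
Proof.
elim: d => // d IHd; rewrite leq_eqVlt => /orP[/eqP<- //|d5].
have := IHd d5; rewrite !ltnS in d5.
have -> : 2 * d.+1 + 1 = (2 * d + 1).+2 by lia.
have X2 : 'C((2 * d + 1).+1, d) >= 'C(2 * d + 1, d) by apply: leq_bin2l.
have X1 : 'C(2 * d + 1, d.+1) = 'C(2 * d + 1, d).
  by rewrite -bin_sub; [congr 'C(_, _)|]; lia.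
rewrite binS (binS _ d) X1; move: X2 {X1}.
move: 'C(_, _) 'C(_, _) => x y; rewrite !expnS !expn0 !muln1; nia.
Qed.

(* [l] is the number of blocks of seven bits gained by the potential argument;
   the first inequality says that enough samples are available for this. *)
Lemma sample_budget d a m (D := d.+1) (X := 'C(2 * d + 1, d)) :
  4 * D <= 2 ^ a < 8 * D -> 2 * D ^ 2 <= m < 4 * D ^ 2 ->
  exists l, (40 * l + 7) * m.+1 <= 189 * X * (m.+1 - (D * D + 'C(D, 2)))
    /\ 'C(m, d) * 2 ^ (a * m) * 2 ^ (3 * X) <= 2 ^ (7 * l).
Proof.
rewrite {}/D {}/X => aD mD.
have bits c l : 'C(m, d) <= 2 ^ c -> c + a * m + 3 * 'C(2 * d + 1, d) <= 7 * l ->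
    'C(m, d) * 2 ^ (a * m) * 2 ^ (3 * 'C(2 * d + 1, d)) <= 2 ^ (7 * l).
  move=> Cc le; apply: (@leq_trans (2 ^ (c + a * m + 3 * 'C(2 * d + 1, d)))).
    by rewrite !expnD !leq_mul.
  by rewrite leq_exp2l.
have Cm e : m <= 2 ^ e -> 'C(m, d) <= 2 ^ (e * d).
  have [->|d0] := posnP d; first by rewrite bin0 muln0.
  by move=> me; apply: leq_trans (leq_bin_exp _ _) _; rewrite expnM leq_exp2r.
have [d5|d5] := ltnP 4 d.
  have [X1 dX] : 0 < 'C(2 * d + 1, d) /\ 2 * d.+1 ^ 3 + d.+1 ^ 2 <= 2 * 'C(2 * d + 1, d).
    by split; [rewrite bin_gt0; lia | exact: cubic_lt_bin].
  (* Here [l = X] works: the subtracted term is at most three quarters of [m.+1], and the events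
     number at most 2^(4X) by [cubic_lt_bin]. *)
  exists 'C(2 * d + 1, d); split.
    have : 4 * (d.+1 * d.+1 + 'C(d.+1, 2)) <= 3 * m.+1.
      have : 'C(d.+1, 2) * 2 = d.+1 * d by rewrite (bin_ffact _ 2) !ffactnS ffactn0 muln1.
      by move: 'C(_, 2) (proj1 (andP mD)) => A; rewrite !expnS expn0; nia.
    move: X1 (_ + 'C(d.+1, 2)) {dX}; move: 'C(_, d) => X X1 A; nia.
  have dexp j : 5 <= j -> 8 * j.+1 <= 2 ^ j.+1.
    elim: j => // j IHj; rewrite leq_eqVlt => /orP[/eqP<- //|]; rewrite ltnS => /IHj.
    by rewrite [2 ^ j.+2]expnS; lia.
  have ad : a < d.+1.
    rewrite -(ltn_exp2l _ _ (isT : 1 < 2)).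
    by apply: leq_trans (dexp d d5); case/andP: aD.
  apply: (bits (2 * d.+1 * d)).
    apply: Cm; rewrite mulnC expnM.
    apply: leq_trans (ltnW (proj2 (andP mD))) _.
    rewrite (_ : 4 * _ = (2 * d.+1) ^ 2); last by rewrite !expnS; lia.
    by rewrite leq_exp2r //; have := dexp d d5; lia.
  have : a * m <= d.+1 * (4 * d.+1 ^ 2) by apply: leq_mul; lia.
  by move: dX; move: 'C(_, d) => X; rewrite !expnS expn0; nia.
(* For [d <= 4] the bracket on [2 ^ a] determines [a], and [l] is given numerically, depending on
   the range of [m] when [d] is 1 or 2. *)
have aE b : 2 ^ b < 2 ^ a < 2 ^ b.+2 -> a = b.+1.
  by rewrite !ltn_exp2l // ltnS; lia.
have eqA D B : D * D.-1 = B * 2 -> D * D + 'C(D, 2) = D * D + B.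
  by rewrite bin2 => ->; rewrite muln2 doubleK.
case: d bits Cm d5 aD mD => [|[|[|[|[|//]]]]] bits Cm _ aD mD.
- rewrite (eqA _ 0) //; have a2 : a = 2 by apply: aE; lia.
  have X1 : 'C(2 * 0 + 1, 0) = 1 by [].
  exists 2; rewrite X1; split; first by lia.
  by apply: (bits (2 * 0)); rewrite ?X1 ?a2; [apply: Cm|]; lia.
- rewrite (eqA _ 1) //; have a3 : a = 3 by apply: aE; lia.
  have X3 : 'C(2 * 1 + 1, 1) = 3 by [].
  have [l [l1 l2]] : exists l, (40 * l + 7) * m.+1 <= 189 * 3 * (m.+1 - 5)
      /\ 4 + 3 * m + 3 * 3 <= 7 * l.
    have [?|?] := leqP m 9; first by exists 6; lia.
    have [?|?] := leqP m 12; first by exists 7; lia.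
    by have [?|?] := leqP m 14; [exists 8|exists 9]; lia.
  exists l; rewrite X3; split=> //.
  by apply: (bits (4 * 1)); rewrite ?X3 ?a3 //; apply: Cm; lia.
- rewrite (eqA _ 3) //; have a4 : a = 4 by apply: aE; lia.
  have X10 : 'C(2 * 2 + 1, 2) = 10 by [].
  have [l [e [l1 l2 me]]] : exists l e, [/\ (40 * l + 7) * m.+1 <= 189 * 10 * (m.+1 - 12),
      e * 2 + 4 * m + 3 * 10 <= 7 * l & m <= 2 ^ e].
    have [?|?] := leqP m 19; first by exists 17, 5; split; lia.
    have [?|?] := leqP m 25; first by exists 20, 5; split; lia.
    by exists 26, 6; split; lia.
  exists l; rewrite X10; split=> //.
  by apply: (bits (e * 2)); rewrite ?X10 ?a4 //; apply: Cm.
- rewrite (eqA _ 6) //; have a4 : a = 4 by apply: aE; lia.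
  have X35 : 'C(2 * 3 + 1, 3) = 35 by [].
  exists 54; rewrite X35; split; first by lia.
  by apply: (bits (6 * 3)); rewrite ?X35 ?a4; [apply: Cm|]; lia.
- rewrite (eqA _ 10) //; have a5 : a = 5 by apply: aE; lia.
  have X126 : 'C(2 * 4 + 1, 4) = 126 by [].
  exists 186; rewrite X126; split; first by lia.
  by apply: (bits (7 * 4)); rewrite ?X126 ?a5; [apply: Cm|]; lia.
Qed.

Lemma quintic_le_exp2 d : 40 <= d -> 128 * d.+1 ^ 5 <= 2 ^ d.
Proof.
elim: d => // d IHd; rewrite leq_eqVlt => /orP[/eqP<-|]; first by lia.
rewrite ltnS => d40; have := IHd d40; rewrite [2 ^ _.+1]expnS.
suff : d.+2 ^ 5 <= 2 * d.+1 ^ 5 by lia.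
have : 40 <= d.+1 by lia.
move: d.+1 => x x40; have x2 : x <= x ^ 2 by rewrite expnS expn1; nia.
have x3 : x ^ 2 <= x ^ 3 by rewrite leq_exp2l; lia.
have x4 : x ^ 3 <= x ^ 4 by rewrite leq_exp2l; lia.
have x5 : 40 * x ^ 4 <= x ^ 5 by rewrite [x ^ 5]expnS leq_mul2r x40 orbT.
have -> : x.+1 ^ 5 = x ^ 5 + 5 * x ^ 4 + 10 * x ^ 3 + 10 * x ^ 2 + 5 * x + 1.
  by rewrite -addn1 !expnS !expn0; lia.
lia.
Qed.

(** The only source of the threshold on [n]: for [d >= 40] the bound follows from [2 ^ d < n], for
    smaller [d] from the size of [n]. *)
Lemma quintic_le_large : exists N, forall n d, N <= n -> 2 ^ d < n -> 128 * d.+1 ^ 5 <= n.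
Proof.
exists (128 * 40 ^ 5) => n d Nn dn; have [d40|d40] := leqP 40 d.
  exact: leq_trans (quintic_le_exp2 d40) (ltnW dn).
by apply: leq_trans Nn; rewrite leq_mul2l leq_exp2r.
Qed.

(** Factor by factor, (A - i) / (B - i) <= A / B. *)
Lemma leq_ffact_ratio A B j : A <= B -> A ^_ j * B ^ j <= A ^ j * B ^_ j.
Proof.
move=> AB; elim: j => // j IHj; rewrite !ffactnSr !expnSr.
have le : (A - j) * B <= A * (B - j).
  by rewrite mulnBl mulnBr leq_sub2l // mulnC leq_mul2l AB orbT.
have := leq_mul IHj le.
by move: (A ^_ j) (B ^_ j) (A ^ j) (B ^ j) (A - j) (B - j) => a b c e f g; lia.
Qed.

(** By [card_far_words] the left side counts some of the words of length [m] over [q] letters. *)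
Lemma leq_far_words q m d D : 0 < q -> d <= m -> 'C(m - d, D) * q.-1 ^ D <= q ^ m.
Proof.
move=> q0 dm.
have [B _ cB] : exists2 B : {set 'I_m}, set0 \subset B & #|B| = d.
  by apply: subset_extend; rewrite cards0 card_ord.
have := card_far_words D ([ffun=> Ordinal q0] : {ffun 'I_m -> 'I_q}) cB.
by rewrite card_ord => <-; apply: leq_trans (max_card _) _; rewrite card_ffun !card_ord.
Qed.

(** Lower bound for the mean number of good samples per event, with [K.+1] absorbing the rounding in
    [K]. Passing from q^D to (q-1)^D costs a factor 3/4, as q >= 4D, and turns 36 into 27; passing
    from (m+1)^D to the falling factorial costs the factor with [m.+1 - _]. *)
Lemma code_density q Q m n d k (D := d.+1) (X := 'C(2 * d + 1, d))
    (K := k * (q ^ m * Q ^ D) %/ 2 ^ n) :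
  4 * D <= q -> 0 < Q -> 2 * D ^ 2 <= m -> n <= m.+1 * (q * Q) -> 2 * d < n ->
  36 * 2 ^ n * X <= k * 'C(n - d, D) ->
  27 * X * (m.+1 - (D * D + 'C(D, 2))) * q ^ m
    <= K.+1 * ('C(m - d, D) * q.-1 ^ D) * m.+1.
Proof.
move=> qD Q0 mD nm dn kbig.
have D0 : 0 < D`! := fact_gt0 D.
have q0 : 0 < q by lia.
have Kk : k * (q ^ m * Q ^ D) <= K.+1 * 2 ^ n by rewrite ltnW // ltn_ceil ?expn_gt0.
have C0 : 0 < 'C(n - d, D) by rewrite bin_gt0 /D; lia.
have le1 : 36 * X * (q ^ m * Q ^ D) <= K.+1 * 'C(n - d, D).
  rewrite -(leq_pmul2r (_ : 0 < 2 ^ n)) ?expn_gt0 //.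
  have := leq_mul kbig (leqnn (q ^ m * Q ^ D)).
  have := leq_mul Kk (leqnn 'C(n - d, D)).
  move: (q ^ m * Q ^ D) (2 ^ n) 'C(n - d, D) K.+1 => a b c e; nia.
have le2 : 'C(n - d, D) * D`! <= (m.+1 * q) ^ D * Q ^ D.
  rewrite bin_ffact -expnMn -mulnA; apply: (@leq_trans ((n - d) ^ D)).
    by elim: (D) => // j IHj; rewrite ffactnSr expnSr; apply: leq_mul (leq_subr _ _).
  by rewrite leq_exp2r // (leq_trans (leq_subr _ _)).
have le3 : 36 * X * q ^ m * D`! <= K.+1 * (m.+1 * q) ^ D.
  rewrite -(leq_pmul2r (_ : 0 < Q ^ D)) ?expn_gt0 ?Q0 //.
  have := leq_mul le1 (leqnn D`!); have := leq_mul (leqnn K.+1) le2.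
  move: (q ^ m) (Q ^ D) 'C(n - d, D) K.+1 D`! ((m.+1 * q) ^ D) => a b c e f g; nia.
have le4 : 3 * q ^ D <= 4 * q.-1 ^ D.
  rewrite -(leq_pmul2r q0); have := bernoulli_exp q D.
  have : q ^ D * (3 * q) <= q ^ D * (4 * (q - D)) by rewrite leq_mul2l; apply/orP; right; lia.
  by move: (q ^ D) (q.-1 ^ D) (q - D) => a b c; nia.
have le5 : m.+1 ^ D * (m.+1 - (D * D + 'C(D, 2))) <= (m - d) ^_ D * m.+1.
  by have := bernoulli_ffact m.+1 D D; rewrite {2}/D subSS.
have := leq_mul le3 (leq_mul le4 le5); rewrite -bin_ffact expnMn.
have gt0 : 0 < 4 * (D`! * (m.+1 ^ D * q ^ D)) by rewrite !muln_gt0 fact_gt0 !expn_gt0 q0.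
move=> le6; rewrite -(leq_pmul2l gt0); move: le6.
generalize (m.+1 - (D * D + 'C(D, 2))) D`! (m.+1 ^ D) (q ^ D) (q.-1 ^ D)
  'C(m - d, D) (q ^ m) K.+1 X => A f a b c e g h i.
lia.
Qed.

(** * Lifting a code to the hypercube *)

From mathcomp Require Import all_order all_algebra finfield.
Import Order.TTheory GRing.Theory Num.Theory.

Section Lifting.
Local Open Scope ring_scope.

(** The elements of [A] are listed, and spare indices repeat one of them, which can only raise the
    counts. *)
Lemma enum_family (T V : finType) (A : {set T}) (g : T -> V) (v0 : V) (k : nat) :
  (#|A| <= k)%N -> exists p : 'I_k -> V, forall Q : pred V,
    (#|[set z in A | Q (g z)]| <= #|[set i | Q (p i)]|)%N.
Proof.
move=> Ak; have [->|/set0Pn[z0 z0A]] := eqVneq A set0.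
  exists (fun=> v0) => Q; rewrite (_ : [set z in _ | _] = set0) ?cards0 //.
  by apply/setP=> z; rewrite !inE.
exists (fun i => g (nth z0 (enum A) i)) => Q.
have -> : #|[set z in A | Q (g z)]| = count (fun z => Q (g z)) (enum A).
  rewrite -sum1_count big_enum_cond -sum1_card.
  by apply: eq_bigl => z; rewrite inE.
rewrite -sum1_count (big_nth z0) big_mkord -cardE.
rewrite (big_ord_widen_cond _ (fun i => Q (g (nth z0 (enum A) i))) (fun=> 1%N) Ak).
rewrite sum1_card; apply/subset_leq_card/subsetP => i.
by rewrite inE unfold_in /= => /andP[].
Qed.

Section Syndrome.
Variables (n m d : nat) (Sg F : finFieldType).
Hypotheses (ch2Sg : 2 \in [pchar Sg]) (ch2F : 2 \in [pchar F]).
Variables (iota : 'I_m * Sg * F -> 'I_n) (al : 'I_m -> F).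
Hypotheses (iota_inj : injective iota) (al_inj : injective al).
Local Notation V := {ffun 'I_n -> bool}.
Local Notation T := ('I_m * Sg * F)%type.

(** Coordinates outside the image of [iota] carry no label, so [n] need not be the number of
    labels. *)
Definition load (G : zmodType) (g : T -> G) (x : V) : G :=
  \sum_(tau | x (iota tau)) g tau.

(** When [v + v = 0], setting and clearing a bit both add its label. *)
Lemma load_hflip (G : zmodType) (g : T -> G) (x : V) W :
  (forall v : G, v + v = 0) ->
  load g (hflip x W) = load g x + \sum_(tau | iota tau \in W) g tau.
Proof.
move=> vv; rewrite /load [LHS]big_mkcond [X in _ = X + _]big_mkcond.
rewrite [X in _ = _ + X]big_mkcond -big_split /=.
apply: eq_bigr => tau _; rewrite ffunE.
by case: (x _); case: (_ \in W); rewrite /= ?addr0 ?add0r.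
Qed.

Definition word : V -> {ffun 'I_m -> Sg} :=
  load (fun tau => [ffun i => if i == tau.1.1 then tau.1.2 else 0]).

Definition syndrome : V -> 'cV[F]_d.+1 :=
  load (fun tau => tau.2 *: \col_k al tau.1.1 ^+ k).

Definition blocks (U : {set 'I_n}) : {set 'I_m} :=
  [set tau.1.1 | tau in [set tau | iota tau \in U]].

Lemma card_blocks U : (#|blocks U| <= #|U|)%N.
Proof.
apply: leq_trans (leq_imset_card _ _) _.
rewrite -(card_imset _ iota_inj); apply/subset_leq_card/subsetP => b.
by case/imsetP=> tau; rewrite inE => tauU ->.
Qed.

(* On a set of [d+1] blocks the change of [word] dictates the [Sg]-labels of the
   bits to flip, and a Vandermonde system then fixes their [F]-labels. *)
Lemma syndrome_solve (u : V) (U : {set 'I_n}) y (t : 'cV[F]_d.+1) :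
  #|hdiff (word u) y| = d.+1 -> [disjoint hdiff (word u) y & blocks U] ->
  exists x : V, [/\ word x = y, syndrome x = t, #|hdiff u x| = d.+1
    & [disjoint hdiff u x & U]].
Proof.
move w0E: (word u) => w0; set J := hdiff _ _ => cJ dJ.
pose e (j : 'I_d.+1) : 'I_m := enum_val (cast_ord (esym cJ) j).
have e_inj : injective e by move=> j j' /enum_val_inj/cast_ord_inj.
have eJ j : e j \in J by apply: enum_valP.
have Je i : i \in J -> exists j, i = e j.
  move=> iJ; exists (cast_ord cJ (enum_rank_in iJ i)).
  by rewrite /e cast_ordK enum_rankK_in.
pose M : 'M[F]_d.+1 := Vandermonde d.+1 (\row_j al (e j)).
have Mu : M \in unitmx.
  rewrite unitmxE unitfE det_Vandermonde; apply/prodf_neq0 => i _.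
  apply/prodf_neq0 => j ij; rewrite !mxE subr_eq0.
  by apply: contraTneq ij => /al_inj/e_inj->; rewrite ltnn.
pose f := invmx M *m (t - syndrome u).
pose tau j : T := (e j, y (e j) - w0 (e j), f j 0).
have tau_inj : injective tau by move=> j j' [/e_inj].
pose W := [set iota (tau j) | j : 'I_d.+1].
have sumW (G : zmodType) (g : T -> G) :
    \sum_(s | iota s \in W) g s = \sum_j g (tau j).
  rewrite (eq_bigl (mem [set tau j | j : 'I_d.+1])) /=.
    rewrite big_imset /=; last by move=> j j' _ _ /tau_inj.
    by apply: eq_bigl.
  move=> s; apply/imsetP/imsetP => [[j _ /iota_inj->]|[j _ ->]]; by exists j.
have addSg (c : Sg) : c + c = 0 by apply: addrr_pchar2.
have addF (c : F) : c + c = 0 by apply: addrr_pchar2.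
exists (hflip u W); split; rewrite ?hdiff_hflip.
- rewrite /word load_hflip; last by move=> v; apply/ffunP=> i; rewrite !ffunE.
  rewrite -/(word u) sumW w0E; apply/ffunP => i; rewrite ffunE sum_ffunE.
  have [iJ|iJ] := boolP (i \in J).
    have [j ->] := Je i iJ; rewrite (bigD1 j) //= !ffunE eqxx big1 => [|j' jj'].
      by rewrite addr0 addrC subrK.
    by rewrite !ffunE (inj_eq e_inj) eq_sym (negbTE jj').
  rewrite big1 => [|j _]; last by rewrite !ffunE; case: eqP iJ => // ->; rewrite eJ.
  by move: iJ; rewrite inE negbK addr0 => /eqP.
- rewrite /syndrome load_hflip; last by move=> v; apply/matrixP=> i j; rewrite !mxE.
  rewrite -/(syndrome u) sumW.
  suff -> : \sum_j (tau j).2 *: \col_k al (tau j).1.1 ^+ k = M *m f.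
    by rewrite mulmxA mulmxV // mul1mx addrC subrK.
  apply/matrixP => k i; rewrite summxE !mxE; apply: eq_bigr => j _.
  by rewrite !mxE mulrC ord1 /tau /= /f mxE.
- by rewrite card_imset ?card_ord // => j j' /iota_inj/tau_inj.
- apply/pred0P => b /=; apply/negbTE/negP => /andP[/imsetP[j _ ->] jU].
  move/pred0P: dJ => /(_ (e j)) /=; rewrite eJ /= => /negP[].
  by apply/imsetP; exists (tau j); rewrite ?inE.
Qed.

(** Averaging over pairs [la] of a shift of the code and a syndrome: the sets [cops la] partition
    all [K * 2 ^ n] pairs, so one of them has at most [k] elements. *)
Lemma spread_structured (K k : nat) (y : 'I_K -> {ffun 'I_m -> Sg}) :
  (forall u (B : {set 'I_m}), (#|B| <= d)%N ->
    ('C(2 * d + 1, d) <= #|[set i | (#|hdiff u (y i)| == d.+1) && [disjoint hdiff u (y i) & B]]|)%N) ->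
  (K * 2 ^ n <= k * (#|Sg| ^ m * #|F| ^ d.+1))%N ->
  exists p : 'I_k -> V, spread d p.
Proof.
move=> yP Kk.
pose cops (la : {ffun 'I_m -> Sg} * 'cV[F]_d.+1) : {set 'I_K * V} :=
  [set z | (word z.2 == y z.1 + la.1) && (syndrome z.2 == la.2)].
have [la lak] : exists la, (#|cops la| <= k)%N.
  apply/existsP; apply: contraLR Kk; rewrite negb_exists -ltnNge => /forallP lt.
  have -> : (K * 2 ^ n = \sum_la #|cops la|)%N.
    have -> : (K * 2 ^ n = \sum_(z : 'I_K * V) 1)%N.
      by rewrite sum1_card card_prod card_ffun !card_ord card_bool.
    rewrite (partition_big (fun z : 'I_K * V => (word z.2 - y z.1, syndrome z.2)) predT) //=.
    apply: eq_bigr => -[c t] _; rewrite -sum1_card; apply: eq_bigl => z.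
    by rewrite inE /= xpair_eqE subr_eq addrC.
  have -> : (#|Sg| ^ m * #|F| ^ d.+1 = #|{: {ffun 'I_m -> Sg} * 'cV[F]_d.+1}|)%N.
    by rewrite card_prod card_ffun card_mx card_ord muln1.
  apply: (@leq_trans (k.+1 * #|{: {ffun 'I_m -> Sg} * 'cV[F]_d.+1}|)).
    by rewrite ltn_pmul2r //; apply/card_gt0P; exists (0, 0).
  rewrite mulnC -sum_nat_const; apply: leq_sum => la _.
  by rewrite ltnNge.
have [p pP] := enum_family (fun z => z.2) [ffun=> false] lak.
exists p => u U cU.
apply: leq_trans (pP (fun x => (#|hdiff u x| == d.+1) && [disjoint hdiff u x & U])).
(* The shift of the code by [la.1] is undone by shifting [word u]. Coordinates of [U] may share a
   block, hence the form [#|B| <= d] in [yP]. *)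
have := yP (word u - la.1) (blocks U); rewrite -{1}cU card_blocks => /(_ isT) /leq_trans; apply.
apply: leq_trans (leq_imset_card fst _); apply/subset_leq_card/subsetP => i.
rewrite inE; have -> : hdiff (word u - la.1) (y i) = hdiff (word u) (y i + la.1).
  by apply/setP=> j; rewrite !inE !ffunE subr_eq.
case/andP=> /eqP cJ dJ.
have [x [wx sx ux dx]] := syndrome_solve la.2 cJ dJ.
by apply/imsetP; exists (i, x); rewrite ?inE //= wx sx ux dx !eqxx.
Qed.

End Syndrome.

End Lifting.

(** * The potential argument *)

Require Import Defs.
From HB Require Import structures.
From mathcomp Require Import ring lra.
From mathcomp Require Import all_classical all_reals all_analysis.
Import numFieldNormedType.Exports.

Section Potential.
Local Open Scope ring_scope.

(** From exp(1/20) >= 21/20, raised to the power 100. *)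
Lemma expR5_ge (R : realType) : 128 <= expR 5 :> R.
Proof.
have -> : 5 = 100%:R * 20^-1 :> R by lra.
rewrite expRM_natl.
apply: (@le_trans _ _ ((21 / 20) ^+ 100)).
  rewrite expr_div_n ler_pdivlMr ?exprn_gt0 // -!natrX -natrM ler_nat; lia.
rewrite lerXn2r ?nnegrE ?expR_ge0 //.
by apply: le_trans (expR_ge1Dx _); lra.
Qed.

(** As 1 - x <= exp(-x) and exp(5) >= 128, every five units of x K gain seven bits. *)
Lemma exprn_1B_le (R : realType) (x : R) (K l : nat) :
  0 <= x -> x <= 1 -> 5 * l%:R <= x * K%:R -> (1 - x) ^+ K <= 128^-1 ^+ l.
Proof.
move=> x0 x1 le5.
have le1 : 1 - x <= expR (- x) by apply: expR_ge1Dx.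
apply: (@le_trans _ _ (expR (- x) ^+ K)).
  by rewrite lerXn2r ?nnegrE ?expR_ge0 ?subr_ge0.
rewrite -expRM_natl.
apply: (@le_trans _ _ (expR (l%:R * - 5))).
  by rewrite ler_expR; lra.
rewrite expRM_natl expRN lerXn2r ?nnegrE ?invr_ge0 ?expR_ge0 //.
by rewrite lef_pV2 ?posrE ?expR_gt0 ?expR5_ge.
Qed.

(* One factor [1/8] per hit: choosing each new sample no worse than average
   multiplies the potential by [1 - (7/8) N / |T|]. *)
Lemma greedy_potential (R : realType) (T E : finType) (P : E -> pred T)
    (S : {set E}) (N K : nat) :
  (0 < #|T|)%N -> (N <= #|T|)%N -> {in S, forall e, (N <= #|P e|)%N} ->
  exists2 s : seq T, size s = K &
    \sum_(e in S) 8^-1 ^+ count (P e) s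
      <= #|S|%:R * (1 - 7 / 8 * (N%:R / #|T|%:R)) ^+ K :> R.
Proof.
move=> T0 NT hitN; elim: K => [|K [s sK IHs]].
  by exists [::] => //=; rewrite expr0 sumr_const mulr1.
set c := 1 - _ in IHs *; set Phi := \sum_(e in S) _ in IHs.
(* Averaging: if every [t] exceeded [c * Phi], so would the mean over [T]. *)
have [t t_le] : exists t : T, \sum_(e in S) 8^-1 ^+ count (P e) (t :: s) <= c * Phi.
  apply: contrapT => /forallNP none.
  have T0' : 0 < #|T|%:R :> R by rewrite ltr0n.
  have : \sum_(t : T) c * Phi < \sum_(t : T) \sum_(e in S) 8^-1 ^+ count (P e) (t :: s).
    case/card_gt0P: T0 => t0 _.
    apply: ltr_sum => [|t _]; last by rewrite ltNge; apply/negP.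
    by apply/hasP; exists t0; rewrite ?mem_index_enum.
  rewrite exchange_big /= sumr_const ltNge; case/negP.
  rewrite -mulrnAl /Phi mulr_sumr; apply: ler_sum => e eS.
  have -> : \sum_(t : T) 8^-1 ^+ (P e t + count (P e) s)
      = (#|T|%:R - 7 / 8 * #|P e|%:R) * 8^-1 ^+ count (P e) s :> R.
    have -> : #|T|%:R - 7 / 8 * #|P e|%:R = \sum_(t : T) 8^-1 ^+ P e t :> R.
      have -> : #|P e| = (\sum_(t : T) P e t)%N.
        rewrite -sum1_card big_mkcond; apply: eq_bigr => t _.
        by rewrite unfold_in; case: (P e t).
      have -> : #|T| = (\sum_(t : T) 1)%N by rewrite sum1_card.
      rewrite !natr_sum mulr_sumr -sumrB; apply: eq_bigr => t _.
      by case: (P e t) => /=; rewrite ?expr1 ?expr0; lra.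
    by rewrite mulr_suml; apply: eq_bigr => t _; rewrite exprD.
  rewrite ler_wpM2r ?exprn_ge0 ?invr_ge0 //.
  rewrite -[c *+ _]mulr_natr /c mulrBl mul1r lerB // -!mulrA mulVf ?gt_eqF // mulr1 !mulrA.
  by rewrite ler_wpM2l ?ler_nat ?hitN //; lra.
exists (t :: s); first by rewrite /= sK.
apply: le_trans t_le _; rewrite exprS mulrCA.
rewrite ler_wpM2l // /c subr_ge0.
have : N%:R / #|T|%:R <= 1 :> R by rewrite ler_pdivrMr ?ltr0n // mul1r ler_nat.
lra.
Qed.

(** The final potential is at most 8^(-X), hence so is each of its terms, which forces at least [X]
    hits. The factor 40 comes from 5 l <= (7/8) (N / |T|) K. *)
Lemma code_exists (R : realType) (T E : finType) (P : E -> pred T)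
    (S : {set E}) (N K X l : nat) :
  (0 < #|T|)%N -> (N <= #|T|)%N -> {in S, forall e, (N <= #|P e|)%N} ->
  (40 * l * #|T| <= 7 * N * K)%N -> (#|S| * 2 ^ (3 * X) <= 2 ^ (7 * l))%N ->
  exists y : 'I_K -> T, {in S, forall e, (X <= #|[set i | P e (y i)]%SET|)%N}.
Proof.
move=> T0 NT hitN lK lX.
have [s sK sle] := greedy_potential R K T0 NT hitN.
have [t0 _] : exists t : T, t \in T by case/card_gt0P: T0 => t; exists t.
have T0' : 0 < #|T|%:R :> R by rewrite ltr0n.
have NT' : N%:R / #|T|%:R <= 1 :> R by rewrite ler_pdivrMr // mul1r ler_nat.
have NT0 : 0 <= N%:R / #|T|%:R :> R by rewrite divr_ge0.
have decay : (1 - 7 / 8 * (N%:R / #|T|%:R)) ^+ K <= 128^-1 ^+ l :> R.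
  apply: exprn_1B_le; [lra|lra|].
  have -> : 7 / 8 * (N%:R / #|T|%:R) * K%:R = 7 / 8 * N%:R * K%:R / #|T|%:R :> R by ring.
  rewrite ler_pdivlMr //.
  by move: lK; rewrite -(ler_nat R) !natrM; lra.
have small : \sum_(e in S) 8^-1 ^+ count (P e) s <= 8^-1 ^+ X :> R.
  apply: le_trans sle _; apply: le_trans (ler_wpM2l _ decay) _ => //.
  rewrite !exprVn ler_pdivrMr ?exprn_gt0 // mulrC ler_pdivlMr ?exprn_gt0 //.
  by rewrite -!natrX -natrM ler_nat; move: lX; rewrite !expnM.
exists (fun i => nth t0 s i) => e eS.
have <- : count (P e) s = #|[set i : 'I_K | P e (nth t0 s i)]%SET|.
  rewrite -sum1_count (big_nth t0) big_mkord sK -sum1_card.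
  by apply: eq_bigl => i; rewrite inE.
have : 8^-1 ^+ count (P e) s <= 8^-1 ^+ X :> R.
  apply: le_trans small; rewrite (bigD1 e) //= lerDl.
  by apply: sumr_ge0 => e' _; rewrite exprn_ge0 ?invr_ge0.
by rewrite !exprVn lef_pV2 ?posrE ?exprn_gt0 // ler_eXn2l // ltr1n.
Qed.

End Potential.

(** Only sets [B] of size exactly [d] enter as events; a smaller one is enlarged, which strengthens
    disjointness. *)
Lemma good_code (R : realType) (Sigma : finType) (m d K X l : nat) :
  0 < #|Sigma| -> d <= m ->
  40 * l * #|Sigma| ^ m <= 7 * ('C(m - d, d.+1) * #|Sigma|.-1 ^ d.+1) * K ->
  'C(m, d) * #|Sigma| ^ m * 2 ^ (3 * X) <= 2 ^ (7 * l) ->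
  exists y : 'I_K -> {ffun 'I_m -> Sigma}, forall u (B : {set 'I_m}), #|B| <= d ->
    X <= #|[set i | (#|hdiff u (y i)| == d.+1) && [disjoint hdiff u (y i) & B]]%SET|.
Proof.
move=> q0 dm lK lX.
have cT : #|{ffun 'I_m -> Sigma}| = #|Sigma| ^ m by rewrite card_ffun card_ord.
pose P (e : {ffun 'I_m -> Sigma} * {set 'I_m}) : pred {ffun 'I_m -> Sigma} :=
  fun y => (#|hdiff e.1 y| == d.+1) && [disjoint hdiff e.1 y & e.2].
pose S := finset.setX [set: {ffun 'I_m -> Sigma}]%SET [set B : {set 'I_m} | #|B| == d]%SET.
have /card_gt0P[a _] := q0.
have NP : {in S, forall e, 'C(m - d, d.+1) * #|Sigma|.-1 ^ d.+1 = #|P e|}.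
  case=> u B; rewrite !inE /= => /eqP cB.
  by rewrite -(card_far_words _ u cB) -cardsE; apply: eq_card => y; rewrite !inE.
have [B0 _ cB0] : exists2 B0 : {set 'I_m}, finset.set0 \subset B0 & #|B0| = d.
  by apply: subset_extend; rewrite finset.cards0 card_ord.
have e0S : ([ffun=> a], B0) \in S by rewrite !inE /= cB0 eqxx.
have [||e eS|||y yP] := @code_exists R _ _ P S ('C(m - d, d.+1) * #|Sigma|.-1 ^ d.+1) K X l.
- by rewrite cT expn_gt0 q0.
- by rewrite (NP _ e0S) max_card.
- by rewrite (NP e).
- by rewrite cT.
- by rewrite cardsX finset.cardsT cT card_draws card_ord [X in X * _]mulnC.
exists y => u B Bd.
have [B' BB' cB'] : exists2 B' : {set 'I_m}, B \subset B' & #|B'| = d.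
  by apply: subset_extend; rewrite Bd card_ord.
have := yP (u, B'); rewrite !inE /= cB' eqxx => /(_ isT) /leq_trans; apply.
apply/subset_leq_card/fintype.subsetP => i; rewrite !inE /P /= => /andP[-> dis] /=.
exact: disjointWr dis.
Qed.

(** The cube itself serves as the set of words, with l = 6X: 40 * 6 <= 7 * 36, and there are at most
    2^(2n) events with n <= 2^d <= X. *)
Lemma spread_direct (R : realType) (n d k : nat) :
  0 < n -> 2 * d <= n -> n <= 2 ^ d ->
  36 * 2 ^ n * 'C(2 * d + 1, d) <= k * 'C(n - d, d.+1) ->
  exists p : 'I_k -> {ffun 'I_n -> bool}, spread d p.
Proof.
move=> n0 dn nd kbig.
have dX := leq_exp2_bin d.
have [||||p pP] := @good_code R bool n d k 'C(2 * d + 1, d) (6 * 'C(2 * d + 1, d)).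
- by rewrite card_bool.
- by lia.
- rewrite card_bool exp1n muln1; lia.
- rewrite card_bool; apply: leq_trans (_ : 2 ^ (n + n + 3 * 'C(2 * d + 1, d)) <= _).
    by rewrite !expnD !leq_mul ?leq_bin_exp2.
  by rewrite leq_exp2l //; lia.
exists p => u U cU; apply: pP; by rewrite cU.
Qed.

Lemma spread_small (R : realType) n d k :
  128 * d.+1 ^ 5 <= n -> 36 * 2 ^ n * 'C(2 * d + 1, d) <= k * 'C(n - d, d.+1) ->
  exists p : 'I_k -> {ffun 'I_n -> bool}, spread d p.
Proof.
move=> dn kbig; set D := d.+1 in dn kbig.
have s0 : 0 < D ^ 2 by rewrite expn_gt0.
have D5 : D ^ 5 = D * D ^ 2 * D ^ 2 by rewrite -mulnA -expnD -expnS.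
have Dss : D * D ^ 2 <= D * D ^ 2 * D ^ 2 by apply: leq_pmulr.
have Ds : D <= D * D ^ 2 by apply: leq_pmulr.
(* [q = 2 ^ a] is at least [4 * D], as [code_density] asks; [r] is maximal such that [2 * D ^ 2]
   blocks of size [q * 2 ^ r] fit, which puts [m] between [2 * D ^ 2] and [4 * D ^ 2]. *)
have [a aD] : exists a, 4 * D <= 2 ^ a < 2 * (4 * D) by apply: exp2_bracket_up.
have [r rn] : exists r, 2 * D ^ 2 * 2 ^ a * 2 ^ r <= n < 2 * (2 * D ^ 2 * 2 ^ a * 2 ^ r).
  apply: exp2_bracket; apply/andP; split; first by rewrite !muln_gt0 !expn_gt0.
  have : D ^ 2 * 2 ^ a <= D ^ 2 * (8 * D) by rewrite leq_mul2l; lia.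
  lia.
set Q := 2 ^ r in rn; set q := 2 ^ a in aD rn.
have q0 : 0 < q by rewrite expn_gt0.
have Q0 : 0 < Q by rewrite expn_gt0.
have qQ0 : 0 < q * Q by rewrite muln_gt0 q0.
pose m := n %/ (q * Q).
have mn : m * (q * Q) <= n by apply: leq_trunc_div.
have nm : n < m.+1 * (q * Q) by apply: ltn_ceil.
have mD : 2 * D ^ 2 <= m < 4 * D ^ 2.
  apply/andP; split; first by rewrite leq_divRL // mulnA; case/andP: rn.
  by rewrite ltn_divLR //; case/andP: rn => _; lia.
(* The field must contain [m] distinct points. Since n < 32 D^3 Q, the hypothesis n >= 128 D^5 gives
   Q > 4 D^2 > m. *)
have QD : 4 * D ^ 2 < Q.
  have : n < 2 * (2 * D ^ 2 * (8 * D) * Q).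
    case/andP: rn => _ /leq_trans; apply.
    by rewrite leq_mul2l leq_mul2r leq_mul2l; apply/orP; right; lia.
  move=> nQ; rewrite ltnNge; apply/negP => /(leq_mul (leqnn (D * D ^ 2))); lia.
have dm : d <= m by move: mD; rewrite /D; nia.
have dn2 : 2 * d < n by move: dn D5; rewrite /D; lia.
have r0 : 0 < r by move: QD; rewrite /Q; case: (r) => //; lia.
have a0 : 0 < a by move: aD; rewrite /q; case: (a) => //; lia.
have [Sg ch2Sg cSg] := pPrimePowerField (isT : prime 2) a0.
have [F ch2F cF] := pPrimePowerField (isT : prime 2) r0.
pose K := k * (q ^ m * Q ^ D) %/ 2 ^ n.
have aD' : 4 * d.+1 <= 2 ^ a < 8 * d.+1 by move: aD; rewrite /q /D; lia.
have [l [l1 l2]] := sample_budget aD' mD.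
have dens := code_density (proj1 (andP aD)) Q0 (proj1 (andP mD)) (ltnW nm) dn2 kbig.
have [||||y yP] := @good_code R Sg m d K 'C(2 * d + 1, d) l.
- by rewrite cSg expn_gt0.
- by [].
(* Here 189 = 7 * 27, and the spare 7 in [sample_budget] pays for [K.+1] in place of [K], as a
   sample hits at most [q ^ m] words. *)
- rewrite cSg; have := leq_far_words D q0 dm.
  move: dens; rewrite -/K -/D -/q -/Q.
  have := leq_mul l1 (leqnn (q ^ m)); rewrite -/D.
  generalize ('C(m - d, D) * q.-1 ^ D) (m.+1 - (D * D + 'C(D, 2))) (q ^ m) K.
  move=> N B b K' le1 le2 Nb; have := leq_mul Nb (leqnn m.+1).
  move: 'C(_, d) le1 le2 => X le1 le2 le3.
  by rewrite -(leq_pmul2r (ltn0Sn m)); lia.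
- by rewrite cSg -expnM; apply: l2.
have iota_ex : #|{: 'I_m * Sg * F}| <= n by rewrite !card_prod card_ord cSg cF -mulnA.
have al_ex : m <= #|F|.
  by rewrite cF; case/andP: mD => _ /ltnW/leq_trans; apply; apply: ltnW.
pose iota (t : 'I_m * Sg * F) : 'I_n := widen_ord iota_ex (enum_rank t).
pose al (i : 'I_m) : F := enum_val (widen_ord al_ex i).
have iota_inj : injective iota.
  by move=> t t' /(congr1 val)/= /ord_inj/enum_rank_inj.
have al_inj : injective al.
  by move=> i i' /enum_val_inj/(congr1 val)/= /ord_inj.
apply: (spread_structured ch2Sg ch2F iota_inj al_inj yP).
by rewrite cSg cF leq_trunc_div.
Qed.

(** * The game *)

Section Capture.
Local Open Scope ring_scope.

Section Game.
Variables (n d k : nat) (p : 'I_k -> {ffun 'I_n -> bool}).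

Lemma moveE (u v : {ffun 'I_n -> bool}) : move (@hypercube n) u v = hnear u v.
Proof.
by rewrite /move /hypercube /hnear -hdiff_eq0 -cards_eq0 leq_eqVlt ltnS leqn0 orbC.
Qed.

(** The strategy reads only the robber's start and the round number. In round [d.+1 + e], for
    [e <= d], the cops occupy the whole sphere of radius [d - e] around the start. *)
Lemma spread_capture : (2 * d <= n)%N -> spread d p ->
  exists2 s : cop_strategy {ffun 'I_n -> bool} k,
    legal_strategy (@hypercube n) s &
    forall r, robber_walk (@hypercube n) r ->
      exists2 t, (t <= 2 * d + 1)%N & captured_in s r t.
Proof.
move=> dn sp; have /choice[w wP] := fun v => closing_walks v dn sp.
pose s (h : seq {ffun 'I_n -> bool}) i :=
  if h is v :: _ then w v i (size h) else p i.
exists s => [h v i|r rw].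
  rewrite moveE; case: h => [|u h] /=.
    by have [w0 ws _] := wP v; rewrite -(w0 i).
  by have [_ ws _] := wP u; rewrite size_rcons.
apply: contrapT => nocap.
have {}nocap t : (t <= 2 * d + 1)%N -> forall i,
    s (mkseq r t) i <> r t.-1 /\ s (mkseq r t) i <> r t.
  move=> td i; split=> e; apply: nocap; exists t => //; exists i; [by left|by right].
have sE t i : s (mkseq r t.+1) i = w (r 0%N) i t.+1.
  by rewrite /s /= size_map size_iota.
have [_ _ wcover] := wP (r 0%N).
have near_step x t : (#|hdiff x (r t.+1)| <= #|hdiff x (r t)|.+1)%N.
  apply: leq_trans (hdiff_triangle _ (r t) _) _.
  by rewrite -[leqRHS]addn1 leq_add2l; have := rw t; rewrite moveE.
have inball t : (#|hdiff (r 0%N) (r t)| <= t)%N.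
  elim: t => [|t IHt]; last by apply: leq_trans (near_step _ _) _.
  by rewrite leqn0 cards_eq0 hdiff_eq0.
(* A robber on the sphere of radius [d - e] after round [d + e] is caught by the next cop move, and
   one ending the next round there runs into a cop; so an uncaught robber is pushed inwards. *)
have shrink e : (e <= d)%N -> (#|hdiff (r 0%N) (r (d + e)%N)| + e <= d)%N.
  elim: e => [|e IHe] ed; first by rewrite !addn0.
  have {IHe} := IHe (ltnW ed); rewrite leq_eqVlt => /orP[/eqP/wcover[i wi]|lte].
    by have [] := nocap (d.+1 + e)%N _ i; rewrite ?sE ?addSn //=; lia.
  have := near_step (r 0%N) (d + e)%N; rewrite -addnS => le1.
  have [/wcover[i wi]|] := eqVneq (#|hdiff (r 0%N) (r (d + e.+1)%N)| + e)%N d; last lia.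
  have [_] := nocap (d.+1 + e)%N ltac:(lia) i.
  by rewrite addSn sE -addSn wi addSnnS.
have [i wi] : exists i, w (r 0%N) i (d.+1 + d)%N = r (d + d)%N.
  by apply: wcover; apply/eqP; rewrite eqn_leq shrink // leq_addl.
by have [] := nocap (d.+1 + d)%N _ i; rewrite ?addSn ?sE //; lia.
Qed.

Lemma capt_le_spread (R : realType) : (2 * d <= n)%N -> spread d p ->
  (capt R (@hypercube n) k <= ((2 * d + 1)%N%:R)%:E)%E.
Proof.
move=> dn /(spread_capture dn)[s ls cs].
apply: (@le_trans _ _ (ereal_sup
  [set capture_round R s r | r in robber_walk (@hypercube n)]%classic)).
  by apply: ereal_inf_lbound; exists s.
apply: ge_ereal_sup => _ [r rw <-].
have [t td ct] := cs r rw.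
apply: (@le_trans _ _ (t%:R)%:E); last by rewrite lee_fin ler_nat.
by apply: ereal_inf_lbound; exists t.
Qed.

End Game.

End Capture.

(** * From spread placements to the asymptotic bounds *)

Unset Implicit Arguments.

Local Open Scope classical_set_scope.
Local Open Scope ring_scope.

Lemma capt_le_large (R : realType) : exists N, forall n d k : nat, (N <= n)%N ->
  (4 * d + 2 <= n)%N ->
  36 * 2 ^+ n * (((2 * d + 1) ^_ (d + 1))%N%:R
                    / ((n - d) ^_ (d + 1))%N%:R) <= k%:R :> R ->
  (capt R (@hypercube n) k <= ((2 * d + 1)%N%:R)%:E)%E.
Proof.
have [N NP] := quintic_le_large.
exists N => n d k Nn dn; rewrite !addn1 mulrA ler_pdivrMr; last first.
  by rewrite ltr0n ffact_gt0; lia.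
(* Both falling factorials are [d.+1]! times a binomial coefficient, and the factorial cancels. *)
rewrite -natrX -!natrM ler_nat -!bin_ffact (mulnA _ _ d.+1`!) (mulnA k).
rewrite leq_pmul2r ?fact_gt0 // => kbig.
have {}kbig : (36 * 2 ^ n * 'C(2 * d + 1, d) <= k * 'C(n - d, d.+1))%N.
  suff <- : 'C((2 * d).+1, d.+1) = 'C(2 * d + 1, d) by [].
  have -> : d.+1 = ((2 * d).+1 - d)%N by lia.
  by rewrite bin_sub ?addn1 //; lia.
suff [p sp] : exists p : 'I_k -> {ffun 'I_n -> bool}, spread d p.
  by rewrite -[(2 * d).+1]addn1; apply: capt_le_spread sp; lia.
(* For [n <= 2 ^ d] the direct potential argument applies; otherwise [d] is at most logarithmic in
   [n] and a code is lifted. *)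
have [nd|nd] := leqP n (2 ^ d).
  by apply: (spread_direct R) => //; lia.
by apply: (spread_small R) => //; apply: NP.
Qed.

(* When [d <= c * n - 2] one has [d <= n], so that the truncated subtraction
   [n - d] is exact. *)
Theorem theorem3p3 (R : realType) (k d : nat -> nat) :
  let c : R := 1 / 2 - Num.sqrt 2 / 4 in
  (\forall n \near \oo,
     (d n)%:R <= c * n%:R - 2 ->
     36 * 2 ^+ n * (((2 * d n + 1) ^_ (d n + 1))%N%:R
                    / ((n - d n) ^_ (d n + 1))%N%:R) <= (k n)%:R :> R ->
     (capt R (@hypercube n) (k n) <= ((2 * d n + 1)%N%:R)%:E)%E)
  /\
  (\forall n \near \oo,
     (0 < d n)%N ->
     (d n)%:R <= c * n%:R - 2 ->
     36 * 2 ^+ n * n%:R * (3 * (d n)%:R / (n%:R * (1 - c))) ^+ (d n + 1)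
       <= (k n)%:R :> R ->
     (capt R (@hypercube n) (k n) <= ((2 * d n + 1)%N%:R)%:E)%E).
Proof.
move=> c; have [N NP] := capt_le_large R.
(* This turns [d <= c * n - 2] into [4 * d + 2 <= n]. *)
have c4 : c <= 1 / 4.
  have : 1 <= Num.sqrt 2 :> R by rewrite -[leLHS]sqrtr1 ler_sqrt // ler1n.
  by rewrite /c; lra.
have dn4 n m : m%:R <= c * n%:R - 2 -> (4 * m + 2 <= n)%N.
  have n0 : 0 <= n%:R :> R by [].
  by move=> le; rewrite -(ler_nat R) natrD natrM; nra.
split; exists N => // n /= Nn.
  by move=> dn; apply: NP => //; apply: dn4.
move=> d0 dn kbig; apply: NP => //; first exact: dn4.
apply: le_trans kbig; rewrite -!mulrA.
have n4 := dn4 _ _ dn.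
have n1 : 1 <= n%:R :> R by rewrite ler1n; lia.
rewrite ler_wpM2l // ler_wpM2l ?exprn_ge0 //.
set m := d n in d0 dn n4 *.
have den0 : 0 < n%:R * (1 - c) by apply: mulr_gt0; lra.
(* The quotient of falling factorials is at most the power of the quotient of bases; here 2m + 1 <=
   3m as m >= 1, and n - m >= n (1 - c). The remaining factor n is at least 1. *)
have base_le : (2 * m + 1)%N%:R / (n - m)%N%:R <= 3 * m%:R / (n%:R * (1 - c)) :> R.
  have mR : 1 <= m%:R :> R by rewrite ler1n.
  rewrite natrB; last by lia.
  apply: ler_pM => //; first by rewrite invr_ge0; nra.
    by rewrite natrD natrM; lra.
  by rewrite lef_pV2 ?posrE //; nra.
apply: (@le_trans _ _ ((3 * m%:R / (n%:R * (1 - c))) ^+ (m + 1))); last first.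
  by rewrite -mulrA ler_peMl // exprn_ge0 // mulr_ge0 // divr_ge0 // ltW.
apply: (@le_trans _ _ (((2 * m + 1)%N%:R / (n - m)%N%:R) ^+ (m + 1))); last first.
  by apply: lerXn2r => //; rewrite nnegrE; apply: divr_ge0; rewrite ?(ltW den0) ?mulr_ge0.
rewrite expr_div_n ler_pdivrMr; last by rewrite ltr0n ffact_gt0; lia.
rewrite mulrAC ler_pdivlMr; last by rewrite exprn_gt0 // ltr0n subn_gt0; lia.
rewrite -!natrX -!natrM ler_nat; apply: leq_ffact_ratio; lia.
Qed.
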